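(* Let $G=(V,E)$ be a connected undirected graph with $n$ vertices, maximum degree $\Delta$, and separation number $s$. Then the randomized query complexity of local search on $G$ is $\Omega\left(\sqrt[4]{\frac{s}{\Delta}}\right)$. (The $\Omega$ is uniform: there are absolute constants $c>0$ and $k_0$ such that for every such graph with $s/\Delta\ge k_0$ the randomized query complexity of local search on $G$ is at least $c\,(s/\Delta)^{1/4}$.)
   Context: Local search: $G=(V,E)$ is a finite connected undirected graph known to the algorithm, and $f:V\to\mathbb{R}$ is an unknown function accessible through an oracle; a query names a vertex $v$ and receives $f(v)$. A vertex $v$ is a local minimum if $f(v)\le f(u)$ for all $\{u,v\}\in E$. The task is to output a local minimum. Randomized query complexity: the minimum over randomized algorithms that, for every input $f$, output a correct solution with probability at least $9/10$, of the worst-case (over inputs) expected number of queries, the expectation being over the algorithm's coin tosses. Separation number: for $H\subseteq V$ and $A\subseteq H$ let $\delta_H(A)$ be the set of vertices of $H\setminus A$ that are adjacent in $G$ to some vertex of $A$. The separation number of $G$ is $$s=\max_{H\subseteq V,\ |H|\ge 2}\ \min_{\substack{A\subseteq H:\\ |H|/4\le |A|\le 3|H|/4}}|\delta_H(A)|.$$ *)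

(* Defs.v *)
From HB Require Import structures.
From mathcomp Require Import all_boot all_order all_algebra.
From mathcomp Require Import all_classical all_reals all_analysis.
Set Implicit Arguments.
Unset Strict Implicit.
Unset Printing Implicit Defensive.
Import Order.TTheory GRing.Theory Num.Theory.
Import numFieldNormedType.Exports.
Local Open Scope ring_scope.

(* A simple undirected graph is a symmetric irreflexive [e : rel V]. *)

Section Graph.
Variables (V : finType) (e : rel V).

Definition max_degree : nat := \max_(v : V) #|[set u | e v u]%SET|.

Definition separator (H A : {set V}) : {set V} :=
  [set v in H :\: A | [exists u in A, e u v]]%SET.

(* |H|/4 <= |A| <= 3|H|/4, with denominators cleared *)
Definition balanced (H A : {set V}) : bool :=
  [&& A \subset H, #|H| <= 4 * #|A| & 4 * #|A| <= 3 * #|H|]%N.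

(* The index #|V| of the minimum bounds every #|separator H A|, and a balanced
   A exists as soon as 2 <= #|H|; so the inner operator is the true minimum. *)
Definition separation_number : nat :=
  \max_(H : {set V} | (2 <= #|H|)%N)
    \big[minn/#|V|]_(A : {set V} | balanced H A) #|separator H A|.

End Graph.

Section Algorithms.
Variables (R : realType) (V : finType).

Definition local_minimum (e : rel V) (f : V -> R) (v : V) : Prop :=
  forall u, e v u -> f v <= f u.

(* A deterministic query algorithm maps the transcript of the (vertex, answer)
   pairs seen so far, oldest first, to its next action: [inl v] queries v,
   [inr v] stops with output v. *)
Definition algorithm := seq (V * R) -> V + V.

Fixpoint transcript (a : algorithm) (f : V -> R) (k : nat) : seq (V * R) :=
  if k is k'.+1 then
    let h := transcript a f k' in
    if a h is inl v then rcons h (v, f v) else h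
  else [::].

Definition outputs (a : algorithm) (f : V -> R) (v : V) : Prop :=
  exists k, a (transcript a f k) = inr v.

(* +oo if the algorithm never stops *)
Definition num_queries (a : algorithm) (f : V -> R) : \bar R :=
  ereal_sup (range (fun k => (size (transcript a f k))%:R%:E)).

(* The coin tosses are drawn from an arbitrary probability space and select a
   deterministic algorithm. Since V is finite, a run on a fixed f has finitely
   many possible transcripts after k steps, so measurability of each single
   action makes [num_queries] and the output measurable in the coins. *)
Record randomized_algorithm := RandomizedAlgorithm {
  coins_display : measure_display ;
  coins : measurableType coins_display ;
  coins_law : probability coins R ;
  run_with : coins -> algorithm ;
  measurable_action : forall (h : seq (V * R)) (x : V + V),
    measurable [set w : coins | run_with w h = x]%classic }.

Definition solves_local_search (e : rel V) (A : randomized_algorithm) : Prop :=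
  forall f : V -> R,
    ((9 / 10)%:E <= coins_law A
      [set w | exists2 v, outputs (run_with w) f v & local_minimum e f v]%classic)%E.

Definition expected_queries (A : randomized_algorithm) (f : V -> R) : \bar R :=
  (\int[coins_law A]_w num_queries (run_with w) f)%E.

Definition worst_case_queries (A : randomized_algorithm) : \bar R :=
  ereal_sup (range (expected_queries A)).

Definition randomized_query_complexity (e : rel V) : \bar R :=
  ereal_inf [set q | exists A : randomized_algorithm,
    solves_local_search e A /\ worst_case_queries A = q]%classic.

End Algorithms.

(* Main.v *)
Require Import Defs.
From mathcomp Require Import all_boot all_order all_algebra.
From mathcomp Require boolp.
From mathcomp Require Import reals zify lra.
Set Implicit Arguments.
Unset Strict Implicit.
Unset Printing Implicit Defensive.
Import Order.TTheory GRing.Theory Num.Theory.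

(* Let H attain the separation number s. For |S| < s the graph G[H \ S] has a
   unique component containing more than half of H, its main part; call a set
   free if it meets the main part of every S with |S| < M. Growing a maximal
   connected non-free set by one adjacent vertex gives a connected free set that
   misses the main part of some S with |S| <= M. If M^2 <= s this can be repeated
   inside the main part of the union of the earlier S's, giving M disjoint
   connected free clusters. Two of them cannot be separated by fewer than M
   vertices, so Menger's theorem joins them by M disjoint paths.

   Hard inputs: a walk visits a random sequence of clusters, using at each step
   one of the M paths at random, and f decreases along it; its only local minimum
   is its end. A fixed vertex lies on a random segment with probability at most
   3/M. Reveal one more segment for free after each query: a query then hits a
   segment beyond the next one with probability at most 3/M per segment, since
   such a segment is independent of everything revealed. Hence T queries on a
   walk of T+1 segments succeed with probability O(T^2/M), and T of order
   sqrt M is needed. *)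

(** * Menger's theorem *)

Section Menger.
Variable V : finType.
Implicit Types (E : {set V * V}) (A B S : {set V}) (p : V * seq V).

Definition edge E : rel V := fun u v => (u, v) \in E.
Definition verts p : seq V := p.1 :: p.2.
Definition target p : V := last p.1 p.2.
Definition joins E A B p : bool :=
  [&& p.1 \in A, path (edge E) p.1 p.2 & target p \in B].
Definition separates E A B S : Prop :=
  forall p, joins E A B p -> exists2 z, z \in verts p & z \in S.

Lemma target_verts p : target p \in verts p.
Proof. exact: mem_last. Qed.

Lemma joins_uniq E A B p : joins E A B p ->
  exists q, [/\ joins E A B q, uniq (verts q) & {subset verts q <= verts p}].
Proof.
case: p => a s /and3P[]; rewrite /target /= => aA ps.
case/shortenP: ps => s' ps' us' ss' lB.
exists (a, s'); split=> //; first by apply/and3P.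
by move=> z; rewrite !inE => /orP[->//|/ss' ->]; rewrite orbT.
Qed.

(** Up to its first vertex in [X] the path only uses edges whose source lies outside [X], and these
    survive in [E']. This turns A-B paths of [E] into A-X paths that avoid the deleted edge. *)
Lemma first_hit E E' (X : {set V}) a s :
  (forall u v, u \notin X -> edge E u v -> edge E' u v) ->
  path (edge E) a s -> has [in X] (a :: s) ->
  exists s', [/\ path (edge E') a s', last a s' \in X & {subset s' <= s}].
Proof.
move=> EE'; elim: s a => [|b s IHs] a /=.
  by rewrite orbF => _ aX; exists [::].
case: (boolP (a \in X)) => [aX|aX] /= /andP[eab pbs] hs; first by exists [::].
have [s' [ps' lX ss']] := IHs b pbs hs.
exists (b :: s'); split=> //=; first by rewrite EE'.
by move=> z; rewrite !inE => /orP[->//|/ss' ->]; rewrite orbT.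
Qed.

Lemma last_hit E E' (Y : {set V}) a s :
  (forall u v, v \notin Y -> edge E u v -> edge E' u v) ->
  path (edge E) a s -> has [in Y] (a :: s) ->
  exists p, [/\ p.1 \in Y, path (edge E') p.1 p.2, target p = last a s
              & {subset verts p <= a :: s}].
Proof.
move=> EE'; elim: s a => [|b s IHs] a.
  by rewrite /= orbF => _ aY; exists (a, [::]); split.
rewrite [has _ _]/= => /andP[eab pbs] aY.
case: (boolP (has [in Y] (b :: s))) => [hs|nhs].
  have [p [pY pp lp sp]] := IHs b pbs hs; exists p; split=> // z /sp zs.
  by rewrite inE zs orbT.
move: aY; rewrite -/(has [in Y] (b :: s)) (negPf nhs) orbF => aY.
exists (a, b :: s); split=> //=; rewrite EE' //=; last first.
  by apply: contra nhs => /= ->.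
move: nhs pbs; rewrite /= negb_or => /andP[_].
elim: s b {IHs eab} => //= c s IHs b; rewrite negb_or => /andP[cY nhs].
by case/andP=> ebc pcs; rewrite EE' //= IHs.
Qed.

(* Goering's proof, by induction on the edges. If deleting the edge (x, y) leaves
   a small separator S, then x |: S and y |: S have exactly k elements; k disjoint
   paths from A to the former and k from the latter to B meet only in S, so that
   they can be concatenated, through the edge (x, y) where needed. *)
Lemma Menger E A B k :
  (forall S, separates E A B S -> k <= #|S|) ->
  exists p : 'I_k -> V * seq V, (forall i, joins E A B (p i)) /\
    (forall i j z, z \in verts (p i) -> z \in verts (p j) -> i = j).
Proof.
move: {2}#|E| (leqnn #|E|) => n; elim: n E A B => [|n IHn] E A B.
  (* Without edges a path is a single vertex, so [A :&: B] separates and its elements serve as the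
     paths. *)
  rewrite leqn0 cards_eq0 => /eqP-> sepk.
  have kAB : k <= #|A :&: B|.
    apply: sepk => -[a [|b s]] /and3P[/= aA ps lB].
      by exists a; rewrite !inE // aA.
    by case/andP: ps; rewrite /edge inE.
  pose v i := enum_val (widen_ord kAB i).
  have vAB i : v i \in A :&: B by apply: enum_valP.
  exists (fun i => (v i, [::])); split=> [i|i j z].
    by move: (vAB i); rewrite !inE /joins => /andP[-> ->].
  rewrite !inE => /eqP-> /eqP/enum_val_inj ij.
  by apply/val_inj; move/(congr1 val): ij.
move=> ltE sepk; have [E0|[[x y] xyE]] := set_0Vmem E.
  by apply: IHn => //; rewrite E0 cards0.
pose E' := E :\ (x, y).
have E'n : #|E'| <= n by rewrite -ltnS (leq_trans _ ltE) // (cardsD1 (x, y) E) xyE.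
have E'E : subrel (edge E') (edge E) by move=> u v; rewrite /edge !inE => /andP[].
have joinsE' A' B' p : joins E' A' B' p -> joins E A' B' p.
  by case/and3P=> pA /(sub_path E'E) pp pB; apply/and3P.
case: (boolp.EM (forall S, separates E' A B S -> k <= #|S|)) => [/(IHn _ _ _ E'n)|].
  by case=> p [pj pd]; exists p; split=> // i; apply: joinsE'.
move=> /boolp.existsNP[S] /boolp.not_implyP[sepS /negP]; rewrite -ltnNge => ltSk.
have EX (X : {set V}) : x \in X ->
    forall u v, u \notin X -> edge E u v -> edge E' u v.
  move=> xX u v uX; rewrite /edge !inE => ->; rewrite andbT xpair_eqE.
  by apply/nandP; left; apply: contraNneq uX => ->.
have EY (Y : {set V}) : y \in Y ->
    forall u v, v \notin Y -> edge E u v -> edge E' u v.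
  move=> yY u v vY; rewrite /edge !inE => ->; rewrite andbT xpair_eqE.
  by apply/nandP; right; apply: contraNneq vY => ->.
have sub_has (Z : {set V}) p : (x \in Z) || (y \in Z) -> S \subset Z ->
    joins E A B p -> has [in Z] (verts p).
  move=> xyZ /subsetP SZ /and3P[pA pp pB]; apply/negbNE/negP => /hasPn nZ.
  case: (sepS p) => [|z zp zS]; last by move/negP: (nZ z zp); apply; apply: SZ.
  apply/and3P; split=> //; move: pp nZ; rewrite /verts.
  elim: (p.2) (p.1) => //= b s IHs a /andP[eab pbs] nZ; apply/andP; split; last first.
    by apply: IHs => // z zb; apply: nZ; rewrite inE zb orbT.
  case/orP: xyZ => [xZ|yZ]; first by apply: (EX Z) => //; apply: nZ; rewrite mem_head.
  by apply: (EY Z) => //; apply: nZ; rewrite !inE eqxx orbT.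
pose X := x |: S; pose Y := y |: S.
have hasX p : joins E A B p -> has [in X] (verts p).
  by apply: sub_has; rewrite ?setU11 // subsetUr.
have hasY p : joins E A B p -> has [in Y] (verts p).
  by apply: sub_has; rewrite ?setU11 ?orbT // subsetUr.
(* If [z |: S] meets every A-B path of [E], it is a separator and has at least [k] elements, while
   [#|S| < k]. *)
have cardk z : (forall p, joins E A B p -> has [in z |: S] (verts p)) ->
    z \notin S /\ #|z |: S| = k.
  move=> hz; have : k <= #|z |: S|.
    by apply: sepk => p /hz/hasP[u up uz]; exists u.
  by rewrite cardsU1; case: (z \in S) => /= kS; split=> //; lia.
have [xS cX] := cardk x hasX; have [yS cY] := cardk y hasY.
have [|p0 [pj0 pd0]] := IHn E' A X E'n.
  move=> Z sepZ; apply: sepk => -[a s] /[dup] pj /and3P[/= aA ps lB].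
  have [|s' [ps' lX ss']] := first_hit (EX X _) ps (hasX _ pj); first by rewrite setU11.
  case: (sepZ (a, s')) => [|z zs zZ]; first by apply/and3P.
  by exists z => //; move: zs; rewrite !inE /= => /orP[->//|/ss' ->]; rewrite orbT.
have [|q0 [qj0 qd0]] := IHn E' Y B E'n.
  move=> Z sepZ; apply: sepk => -[a s] /[dup] pj /and3P[/= aA ps lB].
  have [|p [pY pp lp sp]] := last_hit (EY Y _) ps (hasY _ pj); first by rewrite setU11.
  case: (sepZ p) => [|z zs zZ]; first by apply/and3P; rewrite lp.
  by exists z => //; apply: sp.
have [p] := fin_all_exists (fun i => joins_uniq (pj0 i)).
have [q] := fin_all_exists (fun i => joins_uniq (qj0 i)).
move=> {qj0} qP {pj0} pP.
have pd i j z : z \in verts (p i) -> z \in verts (p j) -> i = j.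
  by case: (pP i) (pP j) => _ _ si [_ _ sj] /si zi /sj zj; apply: (pd0 i j z).
have qd i j z : z \in verts (q i) -> z \in verts (q j) -> i = j.
  by case: (qP i) (qP j) => _ _ si [_ _ sj] /si zi /sj zj; apply: (qd0 i j z).
have onto (Z : {set V}) (g : 'I_k -> V) : injective g -> (forall i, g i \in Z) ->
    #|Z| = k -> forall z, z \in Z -> exists i, g i = z.
  move=> ginj gZ cZ z; suff -> : Z = [set g i | i : 'I_k].
    by case/imsetP=> i _ ->; exists i.
  apply/esym/eqP; rewrite eqEcard card_imset // card_ord cZ leqnn andbT.
  by apply/subsetP=> _ /imsetP[i _ ->].
have tX i : target (p i) \in X by case: (pP i) => /and3P[].
have hY i : (q i).1 \in Y by case: (qP i) => /and3P[].
have tinj : injective (target \o p).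
  by move=> i j /= tij; apply: (pd i j _ (target_verts _)); rewrite tij target_verts.
have hinj : injective (fun i => (q i).1).
  by move=> i j tij; apply: (qd i j _ (mem_head _ _)); rewrite tij mem_head.
(* The [k] disjoint paths end at distinct vertices of [X] and [#|X| = k], so these ends exhaust [X];
   a path can therefore meet [X] only at its own end. *)
have pX i z : z \in X -> z \in verts (p i) -> z = target (p i).
  case/(onto X _ tinj tX cX) => j /= <- jpi.
  by rewrite (pd j i _ _ jpi) // target_verts.
have qY i z : z \in Y -> z \in verts (q i) -> z = (q i).1.
  case/(onto Y _ hinj hY cY) => j /= <- jqi.
  by rewrite (qd j i _ _ jqi) // mem_head.
(* A common vertex splices to an A-B path without (x, y), which has to meet S. *)
have meet i j z : z \in verts (p i) -> z \in verts (q j) ->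
    [/\ z \in S, z = target (p i) & z = (q j).1].
  move=> zp zq.
  suff zS : z \in S by split; [|apply: pX|apply: qY]; rewrite // inE zS orbT.
  case: (pP i) (pX i) => /and3P[pA pp _] pu _ {}pX.
  case: (qP j) (qY j) => /and3P[_ qp qB] qu _ {}qY.
  move: zp zq pA pp pu pX qp qB qu qY; rewrite /verts /target.
  case: (p i) (q j) => a s [b t] /= /splitPl[s1 s2 ls1] /splitPl[t1 t2 lt1].
  rewrite !cat_path !last_cat ls1 lt1 => aA /andP[ps1 ps2] us pX /andP[pt1 pt2] tB ut qY.
  case: (sepS (a, s1 ++ t2)) => [|w wst wS].
    by apply/and3P; rewrite /target /= last_cat cat_path ls1 ps1 pt2.
  have wX : w \in X by rewrite inE wS orbT.
  have wY : w \in Y by rewrite inE wS orbT.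
  move: wst; rewrite /verts /= -cat_cons mem_cat => /orP[ws|wt].
    have := pX w wX; rewrite -cat_cons mem_cat ws => /(_ isT) wE.
    (* Here [w] is the end of the first path and also occurs in [a :: s1]; uniqueness forces [s2] to
       be empty, so [w = z]. *)
    case: s2 wE us {ps2 pX} => [|c s2] wE; first by rewrite -[z]/(last z [::]) -wE.
    rewrite -[_ && _]/(uniq (a :: s1 ++ c :: s2)) -cat_cons cat_uniq => /and3P[_ /hasPn/(_ w) nw _].
    by move: nw; rewrite {1}wE /= mem_last ws => /(_ isT).
  have := qY w wY; rewrite -cat_cons mem_cat wt orbT => /(_ isT) wE.
  case: t1 lt1 ut {pt1 qY} => [|c t1] /= lt1; first by rewrite -lt1 -wE.
  by rewrite !inE !mem_cat -wE wt !orbT.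
(* Ends in [X] are matched with starts in [Y]: vertices of [S] are kept, and [x] goes to [y]. *)
pose phi l := if l == x then y else l.
have phiY l : l \in X -> phi l \in Y.
  by rewrite /phi; case: eqVneq => [|/negPf lx]; rewrite !inE ?eqxx // lx => /= ->; rewrite orbT.
have phi_inj : {in X &, injective phi}.
  move=> u v; rewrite /phi !inE; do 2!case: eqVneq => /= [->|?] //.
  - by move=> _ vS yv; move: yS; rewrite yv vS.
  - by move=> uS _ uy; move: yS; rewrite -uy uS.
have [sg sgP] := fin_all_exists (fun i => onto Y _ hinj hY cY _ (phiY _ (tX i))).
have sg_inj : injective sg.
  move=> i j sij; apply: tinj; apply: phi_inj; rewrite ?tX //=.
  by rewrite -!sgP sij.
(* An end at [x] is followed by the edge to [y], so all of the second path is appended; any other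
   end already is the head of the second path, which is dropped. *)
pose r i : V * seq V :=
  ((p i).1, (p i).2 ++ (if target (p i) == x then verts (q (sg i)) else (q (sg i)).2)).
have rpq i z : z \in verts (r i) -> z \in verts (p i) \/ z \in verts (q (sg i)).
  rewrite /r /verts /= -cat_cons mem_cat => /orP[->|]; first by left.
  by case: ifP => _ zq; right=> //; rewrite inE zq orbT.
exists r; split=> [i|i j z /rpq[] zi /rpq[] zj]; last 1 first.
- by apply: sg_inj; apply: (qd _ _ z).
- have := sgP i; rewrite /phi /joins /r /target /=; case: (pP i) => /and3P[pA pp _] _ _.
  case: (qP (sg i)) => /and3P[_ qp qB] _ _.
  rewrite pA cat_path last_cat (sub_path E'E pp) /=.
  case: eqP => [lx qy|_ <-] /=; rewrite (sub_path E'E qp) //=.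
  by rewrite andbT lx [in edge _ _ _]qy /edge xyE.
- exact: (pd _ _ z).
- have [zS zp zq] := meet _ _ _ zi zj; apply: sg_inj; apply: hinj.
  by rewrite -zq sgP -zp /phi ifN //; apply: contraNneq xS => <-.
- have [zS zp zq] := meet _ _ _ zj zi; apply/esym/sg_inj; apply: hinj.
  by rewrite -zq sgP -zp /phi ifN //; apply: contraNneq xS => <-.
Qed.

End Menger.

(** * Linked clusters in a graph of large separation number *)

Section Connected.
Variables (V : finType) (e : rel V).
Hypothesis sym_e : symmetric e.
Implicit Types (B C S : {set V}).

Definition within B : rel V := fun u v => [&& e u v, u \in B & v \in B].
(** Connectivity of the induced subgraph. The empty set qualifies, and the growth in
    [free_killed_cluster] starts from it. *)
Definition conn B : Prop := {in B &, forall u v, connect (within B) u v}.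

Lemma within_sym B : symmetric (within B).
Proof. by move=> u v; rewrite /within sym_e [(u \in B) && _]andbC. Qed.

Lemma within_connect_sym B : connect_sym (within B).
Proof. exact/sym_connect_sym/within_sym. Qed.

Lemma within_path B u s : u \in B -> path (within B) u s ->
  path e u s /\ {subset u :: s <= B}.
Proof.
elim: s u => [|v s IHs] u uB /=; first by split=> // z; rewrite inE => /eqP->.
case/andP=> /and3P[euv _ vB] /(IHs v vB)[pvs sB]; split; first by rewrite euv.
by move=> z; rewrite inE => /orP[/eqP->|/sB].
Qed.

Lemma conn_from B u0 :
  (forall u, u \in B -> connect (within B) u0 u) -> conn B.
Proof.
move=> h u v uB vB; apply: connect_trans (h v vB).
by rewrite within_connect_sym h.
Qed.

Lemma conn_component B u : conn [set v | connect (within B) u v].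
Proof.
apply: (@conn_from _ u) => v; rewrite inE => /connectP[p].
elim/last_ind: p v => [|p w IHp] v; first by move=> _ ->.
rewrite rcons_path last_rcons => /andP[pp ww] ->.
apply: connect_trans (IHp _ pp erefl) _; apply: connect1.
rewrite /within !inE; case/and3P: (ww) => -> _ _.
have ulp : connect (within B) u (last u p) by apply/connectP; exists p.
by rewrite ulp (connect_trans ulp) // connect1.
Qed.

Lemma conn_add C u v : conn C -> u \in C -> e u v -> conn (v |: C).
Proof.
move=> cC uC euv.
apply: (@conn_from _ u) => w /setU1P[->|wC].
  by apply: connect1; rewrite /within euv setU11 setU1r.
apply: connect_sub (cC u w uC wC) => x y /and3P[exy xC yC]; apply: connect1.
by rewrite /within exy !setU1r.
Qed.

Lemma conn_crossing B C : conn B -> B :&: C != set0 -> ~~ (B \subset C) ->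
  exists u v, [/\ u \in B, u \in C, v \in B, v \notin C & e u v].
Proof.
move=> cB /set0Pn[u /setIP[uB uC]] /subsetPn[v vB vC]; apply: boolp.contrapT => no.
have cl : closed (within B) C.
  apply: intro_closed => [|x y /and3P[exy xB yB] xC]; first exact: within_connect_sym.
  by apply: boolp.contrapT => /negP yC; apply: no; exists x, y.
by have := closed_connect cl (cB u v uB vB); rewrite uC (negPf vC).
Qed.

End Connected.

(** * Main parts, free sets and the disjoint linked clusters *)

Section Clusters.
Variables (V : finType) (e : rel V).
Hypothesis sym_e : symmetric e.
Variables (H : {set V}) (s : nat).
Hypothesis H_gt1 : 1 < #|H|.
Hypothesis sep_H : forall A, balanced H A -> s <= #|separator e H A|.
Implicit Types (B C S : {set V}).

(** Connectivity and the last clause make [B] a component of the graph induced on [H :\: S]. *)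
Definition main_part S B : Prop :=
  [/\ B \subset H :\: S, conn e B, #|H| < 2 * #|B| &
      forall u v, u \in B -> v \in H :\: S -> e u v -> v \in B].

(** Half of [H], rounded down, is balanced, and its separator lies in the other half. *)
Lemma sep_bound : 4 * s <= 3 * #|H|.
Proof.
pose A := [set x in take (#|H|./2) (enum H)].
have cA : #|A| = #|H|./2.
  rewrite cardsE (card_uniqP _) ?take_uniq ?enum_uniq // size_take -cardE.
  by case: ifP; lia.
have AH : A \subset H.
  by apply/subsetP=> x; rewrite inE => /mem_take; rewrite mem_enum.
have bA : balanced H A by rewrite /balanced AH cA; lia.
have := sep_H bA; have : separator e H A \subset H :\: A.
  by apply/subsetP=> v; rewrite inE => /andP[].
by move/subset_leq_card; rewrite cardsD (setIidPr AH) cA; lia.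
Qed.

(** Suppose every component of the graph on [H :\: S] has at most half the size of [H]. A largest
    union [U] of components with at most 3/4 of [H] has its separator inside [S], so it is not
    balanced and has less than 1/4 of [H]. Any further component could then be added, so [U] is all
    of [H :\: S]. *)
Lemma main_part_exists S : #|S| < s -> exists B, main_part S B.
Proof.
move=> ltSs; pose W := H :\: S; pose g := within e W.
pose comp u := [set v | connect g u v].
have compW u : u \in W -> comp u \subset W.
  move=> uW; apply/subsetP=> v; rewrite inE => /connectP[p].
  by case/(within_path uW)=> _ sW ->; apply: sW; apply: mem_last.
have compcl u x y : u \in W -> x \in comp u -> y \in W -> e x y -> y \in comp u.
  move=> uW xu yW exy; have xW := subsetP (compW u uW) _ xu.
  move: xu; rewrite !inE => /connect_trans; apply; apply: connect1.
  by rewrite /g /within exy xW.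
apply: boolp.contrapT => no.
have small u : u \in W -> 2 * #|comp u| <= #|H|.
  move=> uW; rewrite leqNgt; apply/negP => big; apply: no; exists (comp u); split=> //.
  - exact: compW.
  - exact: conn_component.
  - by move=> x y xu yW; apply: compcl.
pose P (U : {set V}) := [&& U \subset W, 4 * #|U| <= 3 * #|H| &
  [forall x in U, forall y in W, e x y ==> (y \in U)]].
have P0 : P set0.
  by rewrite /P sub0set cards0 muln0 /=; apply/forallP=> x; rewrite inE.
case: (@arg_maxnP _ set0 P (fun U => #|U|) P0) => U /and3P[UW cU /forall_inP Ucl] maxU.
have UH : U \subset H by apply: subset_trans UW (subsetDl _ _).
have ltUH : 4 * #|U| < #|H|.
  rewrite ltnNge; apply/negP => leHU.
  have /sep_H : balanced H U by rewrite /balanced UH leHU.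
  apply/negP; rewrite -ltnNge; apply: leq_ltn_trans ltSs; apply: subset_leq_card.
  apply/subsetP=> v; rewrite !inE => /andP[/andP[vU vH] /exists_inP[u uU euv]].
  apply: contraNT vU => vS; move/forall_inP/(_ v): (Ucl u uU); rewrite !inE vS vH.
  by move/(_ isT)/implyP; apply.
have WU : W \subset U.
  apply/subsetP=> v vW; apply/negbNE/negP => vU.
  suff /maxU : P (U :|: comp v).
    apply/negP; rewrite -ltnNge; apply: proper_card; apply/properP.
    by split; [apply: subsetUl | exists v; rewrite // !inE connect0 orbT].
  apply/and3P; split.
  - by rewrite subUset UW compW.
  - by rewrite cardsU; have := small v vW; lia.
  - apply/forall_inP=> x /setUP xUv; apply/forall_inP=> y yW; apply/implyP=> exy.
    apply/setUP; case: xUv => [xU|xv]; [left|right]; last exact: compcl exy.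
    by move/forall_inP/(_ y yW)/implyP: (Ucl x xU); apply.
(* So [S] contains more than 3/4 of [H], which is at least [s] by [sep_bound]. *)
have := sep_bound; have := subset_leq_card WU.
have : #|H :&: S| <= #|S| by rewrite subset_leq_card // subsetIr.
by rewrite cardsD; lia.
Qed.

Definition free M C : Prop :=
  forall S B, #|S| < M -> main_part S B -> C :&: B != set0.

(* Stated for all larger S' so that unions of killing sets can be taken. *)
Definition killed_by C S : Prop :=
  forall S' B, S \subset S' -> main_part S' B -> C :&: B = set0.

Lemma main_part_meet S S' B B' : main_part S B -> main_part S' B' -> B :&: B' != set0.
Proof.
case=> BH _ cB _ [BH' _ cB' _]; rewrite -card_gt0.
have : B :|: B' \subset H.
  by rewrite subUset (subset_trans BH) ?(subset_trans BH') ?subsetDl.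
by move/subset_leq_card; rewrite cardsU; lia.
Qed.

(** [B'] is connected and meets [B]. An edge by which it left [B] would end in [H :\: S'], hence in
    [H :\: S], against the closure of [B]. *)
Lemma main_part_mono S S' B B' :
  S \subset S' -> main_part S B -> main_part S' B' -> B' \subset B.
Proof.
move=> SS' mB mB'; apply/negbNE/negP => nB.
have [BH' cB' _ _] := mB'; have [_ _ _ clB] := mB.
have [u [v [uB' uB vB' vB euv]]] := conn_crossing sym_e cB' (main_part_meet mB' mB) nB.
move/negP: vB; apply; apply: clB euv => //.
by move/subsetP/(_ v vB'): BH'; apply/subsetP/setDS.
Qed.

(** Vertices of [B] are added one by one until the set becomes free. Just before the last vertex
    [v], the set misses the main part of some [S] with fewer than [M] elements. Then [v |: S] kills
    the enlarged set: main parts of larger sets are contained in that of [S], and they avoid [v]. *)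
Lemma free_killed_cluster M B : 0 < M -> 0 < s -> conn e B -> free M B ->
  exists C S, [/\ C \subset B, conn e C, free M C, #|S| <= M & killed_by C S].
Proof.
move=> M0 s0 cB fB.
have [B0 mB0] : exists B0, main_part set0 B0 by apply: main_part_exists; rewrite cards0.
have card0M : #|@set0 V| < M by rewrite cards0.
have grow n C : #|B :\: C| <= n -> C \subset B -> conn e C -> ~ free M C ->
  exists C S, [/\ C \subset B, conn e C, free M C, #|S| <= M & killed_by C S].
  elim: n C => [|n IHn] C cn CB cC nfC.
    case: nfC; suff -> : C = B by [].
    by apply/eqP; rewrite eqEsubset CB -setD_eq0 -cards_eq0 -leqn0.
  have [v vB [vC cvC]] : exists2 v, v \in B & v \notin C /\ conn e (v |: C).
    have [C0|[u uC]] := set_0Vmem C.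
      have /set0Pn[v /setIP[vB _]] := fB set0 B0 card0M mB0.
      exists v; rewrite ?C0 ?inE //.
      by split=> // x y; rewrite !inE !orbF => /eqP-> /eqP->.
    have [||x [v [xB xC vB vC exv]]] := conn_crossing sym_e cB (C := C).
    - by apply/set0Pn; exists u; rewrite inE uC (subsetP CB).
    - by apply/negP=> BC; apply: nfC; suff -> : C = B by []; apply/eqP; rewrite eqEsubset CB.
    - by exists v => //; split=> //; apply: conn_add exv.
  have vCB : v |: C \subset B by rewrite subUset sub1set vB.
  case: (boolp.EM (free M (v |: C))) => [fvC|]; last first.
    apply: IHn => //; rewrite -ltnS; apply: leq_trans cn; apply: proper_card.
    apply/properP; split; first by apply: setDS; apply: subsetUr.
    by exists v; rewrite !inE ?eqxx // vC.
  move: nfC => /boolp.existsNP[S /boolp.existsNP[B1 /boolp.not_implyP[ltS]]].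
  move=> /boolp.not_implyP[mB1 /negP/negbNE/eqP CB1].
  exists (v |: C), (v |: S); split=> //.
    by rewrite cardsU1; case: (v \in S) => /=; lia.
  move=> S' B' SS' mB'; apply/eqP; rewrite -subset0 setIUl subUset.
  have B'B1 : B' \subset B1.
    by apply: main_part_mono mB1 mB'; apply: subset_trans SS'; apply: subsetUr.
  have -> : C :&: B' \subset set0 by rewrite -CB1 setIS.
  rewrite andbT; apply/subsetP=> w; rewrite !inE => /andP[/eqP-> vB'].
  have [/subsetP/(_ v vB') + _ _ _] := mB'.
  by rewrite !inE (subsetP SS') ?setU11.
apply: (grow _ set0 (leqnn _)); first exact: sub0set.
  by move=> u v; rewrite inE.
by move/(_ set0 B0 card0M mB0); rewrite set0I eqxx.
Qed.

(** For [j < M] the killing set has at most [j * M < s] elements, so it has a main part [B]. [B] is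
    free because main parts meet pairwise, and it misses all earlier clusters; the next cluster is
    grown inside it. *)
Lemma clusters_upto M j : 0 < M -> M * M <= s -> j <= M ->
  exists (C : nat -> {set V}) S,
    [/\ forall i, i < j -> conn e (C i) /\ free M (C i),
        forall i i', i < j -> i' < j -> i != i' -> [disjoint C i & C i'],
        #|S| <= j * M & forall i, i < j -> killed_by (C i) S].
Proof.
move=> M0 Ms; elim: j => [|j IHj] jM.
  by exists (fun _ => set0), set0; rewrite cards0; split.
have [C [S [cfC dC cS kC]]] := IHj (ltnW jM).
have ltSs : #|S| < s by nia.
have [B mB] := main_part_exists ltSs; have [BH cB _ _] := mB.
have fB : free M B by move=> S' B' _; apply: main_part_meet mB.
have [|D [S' [DB cD fD cS' kD]]] := free_killed_cluster M0 _ cB fB.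
  by apply: leq_trans ltSs.
have CD i : i < j -> [disjoint C i & D].
  move=> ij; apply: disjointWr DB _; rewrite -setI_eq0.
  by apply/eqP; apply: kC ij _ _ _ mB.
exists (fun i => if i < j then C i else D), (S :|: S'); split.
- by move=> i _; case: ifP => // /cfC.
- move=> i i'; rewrite !ltnS => ij i'j ii'; case: ltnP => i1; case: ltnP => i2.
  + exact: dC.
  + exact: CD.
  + by rewrite disjoint_sym CD.
  + by case/eqP: ii'; lia.
- by apply: leq_trans (leq_card_setU _ _) _; lia.
- move=> i _; case: ifP => ij S2 B2; rewrite subUset => /andP[h1 h2].
    exact: (kC i ij).
  exact: kD.
Qed.

(** A set of fewer than [M] vertices has a connected main part which avoids it and meets both [C]
    and [D], so it cannot separate them. *)
Lemma free_linked M C D : M <= s -> free M C -> free M D ->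
  exists p : 'I_M -> V * seq V,
    (forall i, joins [set uv | e uv.1 uv.2] C D (p i)) /\
    (forall i j z, z \in verts (p i) -> z \in verts (p j) -> i = j).
Proof.
move=> Ms fC fD; apply: Menger => S sepS; rewrite leqNgt; apply/negP => ltSM.
have [B mB] := main_part_exists (leq_trans ltSM Ms); have [BH cB _ _] := mB.
have /set0Pn[u /setIP[uC uB]] := fC S B ltSM mB.
have /set0Pn[v /setIP[vD vB]] := fD S B ltSM mB.
have /connectP[q qp qv] := cB u v uB vB.
have [qe qB] := within_path uB qp.
case: (sepS (u, q)) => [|z /qB zB zS].
  rewrite /joins /= uC /target /= -qv vD andbT.
  by apply: sub_path qe => x y; rewrite /edge inE.
by move/subsetP/(_ z zB): BH; rewrite inE zS.
Qed.

(** [r i] represents cluster [i]. The segment from [x] with choice [(y, l)] runs inside cluster [x],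
    along the [l]-th of the disjoint paths from [x] to [y], then inside cluster [y] to [r y]. *)
Lemma low_congestion_routing M : 0 < M -> M * M <= s ->
  exists (r : 'I_M -> V) (seg : 'I_M -> 'I_M * 'I_M -> seq V),
    [/\ injective r,
        forall x o, path e (r x) (seg x o) /\ last (r x) (seg x o) = r o.1 &
        forall v, #|[set q : 'I_M * ('I_M * 'I_M) | v \in seg q.1 q.2]| <= 3 * (M * M)].
Proof.
move=> M0 Ms; have [C0 [S [cfC0 dC0 _ _]]] := clusters_upto M0 Ms (leqnn M).
pose C (i : 'I_M) := C0 i.
have cC i : conn e (C i) by have [] := cfC0 i (ltn_ord i).
have fC i : free M (C i) by have [] := cfC0 i (ltn_ord i).
have dC v i j : v \in C i -> v \in C j -> i = j.
  move=> vi vj; apply/eqP/negbNE/negP => ij.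
  by have := disjointFr (dC0 i j (ltn_ord i) (ltn_ord j) ij) vi; rewrite vj.
have Ms' : M <= s by nia.
have [p pP] := fin_all_exists (fun x : 'I_M * 'I_M => free_linked Ms' (fC x.1) (fC x.2)).
have [B0 mB0] : exists B0, main_part set0 B0.
  by apply: main_part_exists; rewrite cards0 (leq_trans M0).
have card0M : #|@set0 V| < M by rewrite cards0.
have [r rC] : exists r : 'I_M -> V, forall i, r i \in C i.
  apply: (fin_all_exists (P := fun i v => v \in C i)) => i.
  by have /set0Pn[v /setIP[vC _]] := fC i set0 B0 card0M mB0; exists v.
have inC i u v : u \in C i -> v \in C i ->
    exists q, [/\ path e u q, last u q = v & {subset u :: q <= C i}].
  move=> uC vC; have /connectP[q /(within_path uC)[qe qC] ->] := cC i u v uC vC.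
  by exists q.
have segs (q : 'I_M * ('I_M * 'I_M)) : exists w, [/\ path e (r q.1) w,
    last (r q.1) w = r q.2.1 & forall v, v \in w ->
    [\/ v \in C q.1, v \in verts (p (q.1, q.2.1) q.2.2) | v \in C q.2.1]].
  case: q => x [y l] /=; have [/(_ l)/and3P[/= pC pp pD] _] := pP (x, y).
  have [w1 [w1p w1l w1C]] := inC x _ _ (rC x) pC.
  have [w2 [w2p w2l w2C]] := inC y _ _ pD (rC y).
  exists (w1 ++ (p (x, y) l).2 ++ w2); split.
  - rewrite !cat_path w1p w1l w2p andbT /=; apply: sub_path pp => u v.
    by rewrite /edge inE.
  - by rewrite !last_cat w1l.
  - move=> v; rewrite !mem_cat => /or3P[v1|v2|v3].
    + by constructor 1; apply: w1C; rewrite inE v1 orbT.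
    + by constructor 2; rewrite inE v2 orbT.
    + by constructor 3; apply: w2C; rewrite inE v3 orbT.
have [w wP] := fin_all_exists segs.
exists r, (fun x o => w (x, o)); split.
- by move=> i j rij; apply: (dC (r i)); rewrite // rij.
- by move=> x o; have [] := wP (x, o).
(* Each reason for [v] to lie on a segment determines one coordinate of the triple [(x, (y, l))]:
   disjoint clusters determine [x] or [y], disjoint paths determine [l] from [x] and [y]. *)
- move=> v; pose A1 := [set q : 'I_M * ('I_M * 'I_M) | v \in C q.1].
  pose A2 := [set q : 'I_M * ('I_M * 'I_M) | v \in verts (p (q.1, q.2.1) q.2.2)].
  pose A3 := [set q : 'I_M * ('I_M * 'I_M) | v \in C q.2.1].
  have MM : #|{: 'I_M * 'I_M}| = M * M by rewrite card_prod card_ord.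
  have c1 : #|A1| <= M * M.
    rewrite -MM; apply: (leq_card_in (fun q => q.2)) => -[x o] [x' o'].
    by rewrite !inE /= => vx vx' ->; rewrite (dC _ _ _ vx vx').
  have c2 : #|A2| <= M * M.
    rewrite -MM; apply: (leq_card_in (fun q => (q.1, q.2.1))).
    move=> [x [y l]] [x' [y' l']]; rewrite !inE /=.
    move=> vx + [xx yy]; rewrite -xx -yy => vx'.
    by have [_ /(_ _ _ _ vx vx') ->] := pP (x, y).
  have c3 : #|A3| <= M * M.
    rewrite -MM; apply: (leq_card_in (fun q => (q.1, q.2.2))).
    move=> [x [y l]] [x' [y' l']]; rewrite !inE /= => vx vx' [-> ->].
    by rewrite (dC _ _ _ vx vx').
  apply: (@leq_trans #|A1 :|: A2 :|: A3|); last first.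
    apply: leq_trans (leq_card_setU _ _) _; rewrite mulSn mul2n -addnn addnA leq_add //.
    by apply: leq_trans (leq_card_setU _ _) _; rewrite leq_add.
  apply: subset_leq_card; apply/subsetP=> -[x o]; rewrite inE /=.
  by case: (wP (x, o)) => _ _ /[apply] -[] h;
    rewrite !in_setU [_ \in A1]inE [_ \in A2]inE [_ \in A3]inE h ?orbT.
Qed.

End Clusters.

(** * The hard distribution *)

Local Open Scope ring_scope.

Section Staircase.
Variables (R : realType) (V : finType) (e : rel V).

(* The value on the walk is minus the last (1-based) position of the vertex. *)
Definition staircase (D : V -> nat) (w : seq V) (v : V) : R :=
  if v \in w then - (size w - index v (rev w))%:R else (D v)%:R.

Lemma staircase_cat D w w' v : v \notin w' ->
  staircase D (w ++ w') v = staircase D w v.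
Proof.
move=> vw'; rewrite /staircase mem_cat (negPf vw') orbF; case: ifP => // vw.
rewrite rev_cat index_cat mem_rev (negPf vw') size_cat size_rev.
by rewrite [(size w + _)%N]addnC subnDl.
Qed.

Lemma staircase_rcons D w u v :
  staircase D (rcons w u) v =
  if v == u then - (size w).+1%:R else staircase D w v.
Proof.
case: eqVneq => [->|vu]; last by rewrite -cats1 staircase_cat // inE.
by rewrite /staircase mem_rcons mem_head rev_rcons /= eqxx size_rcons subn0.
Qed.

Lemma staircase_ge D w v : - (size w)%:R <= staircase D w v.
Proof.
rewrite /staircase; case: ifP => _; first by rewrite lerN2 ler_nat leq_subr.
by apply: (@le_trans _ _ 0); rewrite ?oppr_le0 ?ler0n.
Qed.

(** Off the walk [D] decreases towards [r]. On the walk, the successor of the last visit to a vertex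
    has a later last position, hence a smaller value. *)
Lemma staircase_local_minimum D r w v :
  (forall u, u != r -> exists2 x, e u x & (D x < D u)%N) ->
  path e r w -> local_minimum e (staircase D w) v -> v = last r w.
Proof.
move=> dD pw minv; apply/eqP/negbNE/negP => nv.
suff [u evu] : exists2 u, e v u & staircase D w u < staircase D w v.
  by rewrite ltNge minv.
elim/last_ind: w pw v nv {minv} => [|w x IHw] /=.
  move=> _ v /dD[u evu ltD]; exists u => //.
  by rewrite /staircase !in_nil ltr_nat.
rewrite rcons_path last_rcons => /andP[pw lx] v vx.
rewrite staircase_rcons (negPf vx).
have ltx : - (size w).+1%:R < - (size w)%:R :> R by rewrite ltrN2 ltr_nat.
have [->|vl] := eqVneq v (last r w).
  exists x => //; rewrite staircase_rcons eqxx.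
  exact: lt_le_trans ltx (staircase_ge _ _ _).
have [u evu ltu] := IHw pw v vl; exists u => //; rewrite staircase_rcons.
by case: eqP => // _; apply: lt_le_trans ltx (staircase_ge _ _ _).
Qed.

(** The graph distance to [r] works: the first step of a shortest path decreases it. *)
Lemma distance_to r : (forall u v, connect e u v) ->
  exists D : V -> nat, forall u, u != r -> exists2 x, e u x & (D x < D u)%N.
Proof.
move=> conn_e.
pose P u n := [exists p : n.-tuple V, path e u p && (last u p == r)].
have exP u : exists n, P u n.
  have /connectP[p pp pr] := conn_e u r; exists (size p); apply/existsP.
  by exists (in_tuple p); rewrite pp -pr eqxx.
exists (fun u => ex_minn (exP u)) => u ur.
case: ex_minnP => n /existsP[[p /= /eqP szp] /andP[pp lp]] _.
case: p szp pp lp => [|x p] /= szp; first by rewrite (negPf ur).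
case/andP=> eux px lp; exists x => //.
case: ex_minnP => m _ minm; rewrite -szp ltnS; apply: minm.
by apply/existsP; exists (in_tuple p); rewrite px.
Qed.

End Staircase.

(** * Runs of a deterministic algorithm *)

Section Transcript.
Variables (R : realType) (V : finType) (a : algorithm R V).

Lemma transcript_eq f g k :
  (forall t v, (t < k)%N -> a (transcript a f t) = inl v -> f v = g v) ->
  transcript a f k = transcript a g k.
Proof.
elim: k => //= k IHk fg; rewrite -IHk => [|t v tk]; last by apply: fg; lia.
by case E: (a _) => [v|//]; rewrite (fg k).
Qed.

Lemma transcript_stop f k n v : (k <= n)%N ->
  a (transcript a f k) = inr v -> transcript a f n = transcript a f k.
Proof.
move=> kn ak; elim: n kn => [|n IHn]; first by rewrite leqn0 => /eqP->.
rewrite leq_eqVlt => /orP[/eqP<-//|kn] /=.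
by rewrite IHn // ak.
Qed.

Lemma size_transcript f k v :
  a (transcript a f k) = inl v -> size (transcript a f k) = k.
Proof.
elim: k v => //= k IHk v; case E: (a (transcript a f k)) => [u|u].
  by rewrite size_rcons (IHk _ E).
by rewrite E.
Qed.

Lemma transcript_map f k :
  transcript a f k = [seq (v, f v) | v <- unzip1 (transcript a f k)].
Proof.
elim: k => //= k IHk; case E: (a _) => [v|//].
by rewrite /unzip1 map_rcons map_rcons -/unzip1 -IHk.
Qed.

End Transcript.

Lemma card_sum_bool (I : finType) (P : pred I) : #|[set x | P x]| = (\sum_x P x)%N.
Proof. by rewrite -sum1dep_card big_mkcond; apply: eq_bigr => x _; case: (P x). Qed.

(* Double counting along the involution (w, x) |-> (upd w x, get w): here upd
   overwrites some coordinates of w, and get reads them. *)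
Lemma resampling (O U : finType) (upd : O -> U -> O) (get : O -> U) (P : pred O) B :
  (forall w x, get (upd w x) = x) -> (forall w x, upd (upd w x) (get w) = w) ->
  (forall w, #|[set x | P (upd w x)]| <= B)%N ->
  (#|[set w | P w]| * #|U| <= #|O| * B)%N.
Proof.
move=> getK updK leB.
have -> : (#|[set w | P w]| * #|U|)%N = (\sum_(w : O * U) P w.1)%N.
  rewrite -(pair_bigA _ (fun w x => P w : nat)) /=.
  under eq_bigr => w _ do rewrite sum_nat_const.
  by rewrite -big_distrr /= mulnC card_sum_bool.
pose phi (w : O * U) := (upd w.1 w.2, get w.1).
have phiK : involutive phi by case=> w x; rewrite /phi /= getK updK.
rewrite (reindex_inj (inv_inj phiK)) -(pair_bigA _ (fun w x => P (upd w x) : nat)) /=.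
rewrite -sum_nat_const; apply: leq_sum => w _; apply: leq_trans (leB w).
by rewrite card_sum_bool.
Qed.

(** * Success of a deterministic algorithm on a random walk through the clusters *)

Section HardDistribution.
Variables (R : realType) (V : finType) (M T : nat).
Variables (r : 'I_M -> V) (seg : 'I_M -> 'I_M * 'I_M -> seq V).
Hypothesis r_inj : injective r.
Hypothesis seg_congestion : forall v,
  (#|[set q : 'I_M * ('I_M * 'I_M) | v \in seg q.1 q.2]| <= 3 * (M * M))%N.
Variables (x0 : 'I_M) (D : V -> nat).

(** Coordinate [i] holds the target cluster of segment [i] and the number of the path used to reach
    it. *)
Let omega := {ffun 'I_T.+1 -> 'I_M * 'I_M}.
Implicit Types (w : omega) (a : algorithm R V).

Definition milestone w j : 'I_M := if j is j'.+1 then (w (inord j')).1 else x0.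
Definition segment w j : seq V := seg (milestone w j) (w (inord j)).
Definition walk w k : seq V := flatten [seq segment w j | j <- iota 0 k].
(* The vertices of the first k segments only: the input hard w T.+1 is compared
   with the truncations hard w t, which do not depend on w i for i >= t. *)
Definition hard w k : V -> R := staircase R D (walk w k).

Lemma walkS w k : walk w k.+1 = walk w k ++ segment w k.
Proof. by rewrite /walk -addn1 iotaD map_cat flatten_cat /= cats0. Qed.

Lemma walk_path (e : rel V) w k :
  (forall x o, path e (r x) (seg x o) /\ last (r x) (seg x o) = r o.1) ->
  path e (r x0) (walk w k) /\ last (r x0) (walk w k) = r (milestone w k).
Proof.
move=> seg_path; elim: k => [//|k [pk lk]]; rewrite walkS cat_path last_cat pk lk.
exact: seg_path.
Qed.

Lemma hard_stable w k n v : (k <= n)%N ->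
  (forall j, (k <= j < n)%N -> v \notin segment w j) -> hard w n v = hard w k v.
Proof.
move=> kn; elim: n kn => [|n IHn]; first by rewrite leqn0 => /eqP->.
rewrite leq_eqVlt => /orP[/eqP->//|kn] vseg.
rewrite /hard walkS staircase_cat; first by apply: IHn => // j jn; apply: vseg; lia.
by apply: vseg; lia.
Qed.

Lemma hard_local w w' k :
  (forall j, (j < k)%N -> w (inord j) = w' (inord j)) -> hard w k = hard w' k.
Proof.
move=> ww'; rewrite /hard; congr staircase; elim: k ww' => // k IHk ww'.
rewrite !walkS IHk => [|j jk]; last by apply: ww'; lia.
rewrite /segment ww' //; case: k ww' {IHk} => [|k] //= ww'.
by rewrite (ww' k) //; lia.
Qed.

(* What the algorithm does at step t, provided no earlier query was an early hit. *)
Definition action a w t : V + V := a (transcript a (hard w t) t).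

(** Counted only for [t < j]: segment [t] is the one revealed for free after query [t]. *)
Definition early_hit a t j w : bool :=
  if action a w t is inl v then v \in segment w j else false.

Definition lucky_guess a w : bool := action a w T == inr (r (milestone w T.+1)).

Definition success a w : bool :=
  a (transcript a (hard w T.+1) T) == inr (r (milestone w T.+1)).

Lemma success_cases a w : success a w ->
  [exists t : 'I_T, exists j : 'I_T.+1, (t < j)%N && early_hit a t j w] || lucky_guess a w.
Proof.
move=> sw; apply/norP => -[/existsPn no]; apply/negP/negPn.
have no_hit t j : (t < j)%N -> (j < T.+1)%N -> ~~ early_hit a t j w.
  move=> tj jT; have tT : (t < T)%N by lia.
  by move/existsPn/(_ (Ordinal jT)): (no (Ordinal tT)); rewrite /= tj.
(* Without early hits, a query at step [t < k] avoids all segments from [k] on, so the full input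
   and its truncation answer it alike. *)
suff trE k : (k <= T)%N -> transcript a (hard w T.+1) k = transcript a (hard w k) k.
  by rewrite /lucky_guess /action -trE.
elim/ltn_ind: k => k IHk kT; apply: transcript_eq => t v tk av.
apply: hard_stable => [|j /andP[kj jT]]; first by lia.
have := @no_hit t j; rewrite /early_hit /action -IHk ?av //; last by lia.
by apply; lia.
Qed.

Lemma inord_neq i j : (i < T.+1)%N -> (j < T.+1)%N -> i != j ->
  (inord i : 'I_T.+1) != inord j.
Proof. by move=> iT jT ij; rewrite -val_eqE /= !inordK. Qed.

Lemma action_local a w w' t :
  (forall j, (j < t)%N -> w (inord j) = w' (inord j)) -> action a w t = action a w' t.
Proof. by move=> ww'; rewrite /action (hard_local ww'). Qed.

Lemma card_early_hit a t j : (t < j < T.+1)%N ->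
  (#|[set w | early_hit a t j w]| * M <= 3 * #|{: omega}|)%N.
Proof.
move=> /andP[tj jT]; case: j tj jT => // j tj jT.
pose i1 : 'I_T.+1 := inord j; pose i2 : 'I_T.+1 := inord j.+1.
have i12 : i1 != i2 by apply: inord_neq; lia.
(* Segment j.+1 depends only on the coordinates j and j.+1, both of index >= t. *)
pose upd w (x : ('I_M * 'I_M) * ('I_M * 'I_M)) : omega :=
  [ffun i => if i == i1 then x.1 else if i == i2 then x.2 else w i].
pose get w := (w i1, w i2).
have updE w x k : (k < t)%N -> upd w x (inord k) = w (inord k).
  by move=> kt; rewrite ffunE !ifN //; apply: inord_neq; lia.
have M0 : (0 < M)%N by apply: leq_ltn_trans (ltn_ord x0).
(* Of the [M ^ 4] resampled values, the congestion bound allows [3 * (M * M)] triples, times [M] for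
   the path number of coordinate [j], on which the segment does not depend. *)
have := @resampling omega _ upd get (early_hit a t j.+1) (M * (3 * (M * M))).
rewrite !card_prod !card_ord => resamp.
suff : (#|[set w | early_hit a t j.+1 w]| * (M * M * (M * M)) <=
    #|{: omega}| * (M * (3 * (M * M))))%N.
  rewrite (_ : _ * (M * M * _) = #|[set w | early_hit a t j.+1 w]| * M * (M * M * M))%N; last by lia.
  rewrite (_ : _ * (M * (3 * _)) = 3 * #|{: omega}| * (M * M * M))%N; last by lia.
  by rewrite leq_pmul2r // !muln_gt0 M0.
apply: resamp => [w [x y]|w x|w].
- by rewrite /get /upd !ffunE !eqxx ifN // eq_sym.
- by apply/ffunP=> i; rewrite !ffunE /=; case: eqP => [->//|_]; case: eqP => [->|].
- case E: (action a w t) => [v|v]; last first.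
    rewrite (_ : [set x | _] = set0) ?cards0 //; apply/setP=> x; rewrite !inE.
    by rewrite /early_hit (@action_local a _ w) ?E // => k; apply: updE.
  pose g (x : ('I_M * 'I_M) * ('I_M * 'I_M)) := (x.1.2, (x.1.1, x.2)).
  have ginj : injective g by case=> [[x1 x2] y] [[x1' x2'] y'] [-> -> ->].
  rewrite -(card_imset _ ginj) -[X in (X * _)%N]card_ord -cardsT.
  apply: leq_trans (leq_mul (leqnn _) (seg_congestion v)); rewrite -cardsX.
  apply: subset_leq_card; apply/subsetP=> _ /imsetP[[[x l] y] + ->].
  rewrite !inE /early_hit (@action_local a _ w) ?E => [|k]; last exact: updE.
  by rewrite /segment /= !ffunE !eqxx ifN //= eq_sym.
Qed.

(** The guess is made without coordinate [T]. As [r] is injective, for each path number at most one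
    target cluster makes it right. *)
Lemma card_lucky_guess a : (#|[set w | lucky_guess a w]| * M <= #|{: omega}|)%N.
Proof.
pose i0 : 'I_T.+1 := inord T.
pose upd w (x : 'I_M * 'I_M) : omega := [ffun i => if i == i0 then x else w i].
have updE w x k : (k < T)%N -> upd w x (inord k) = w (inord k).
  by move=> kt; rewrite ffunE !ifN //; apply: inord_neq; lia.
have M0 : (0 < M)%N by apply: leq_ltn_trans (ltn_ord x0).
have := @resampling omega _ upd (fun w => w i0) (lucky_guess a) M.
rewrite card_prod card_ord mulnA leq_pmul2r //; apply=> [w x|w x|w].
- by rewrite ffunE eqxx.
- by apply/ffunP=> i; rewrite !ffunE; case: eqP => [->|].
- rewrite -[X in (_ <= X)%N]card_ord -(card_in_imset (f := fun x => x.2)) ?max_card //.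
  move=> [x l] [x' l'] /=; rewrite !inE /lucky_guess /milestone !ffunE eqxx /=.
  rewrite !(@action_local a (upd w _) w); try by move=> k; apply: updE.
  by move=> /eqP-> /eqP[/r_inj<-] ->.
Qed.

(** Union bound over at most [T * T.+1] early hits, of probability at most 3/M each, and the lucky
    guess, of probability at most 1/M. *)
Lemma card_success a :
  (#|[set w | success a w]| * M <= (3 * (T * T.+1) + 1) * #|{: omega}|)%N.
Proof.
apply: (@leq_trans ((\sum_(t < T) \sum_(j < T.+1 | t < j) #|[set w | early_hit a t j w]| +
    #|[set w | lucky_guess a w]|) * M)%N).
  rewrite leq_mul2r; apply/orP; right.
  have -> : (\sum_(t < T) \sum_(j < T.+1 | t < j) #|[set w | early_hit a t j w]| =
      \sum_(t < T) \sum_w \sum_(j < T.+1 | t < j) early_hit a t j w)%N.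
    apply: eq_bigr => t _; rewrite exchange_big; apply: eq_bigr => j _.
    exact: card_sum_bool.
  rewrite !card_sum_bool.
  rewrite exchange_big /= -big_split /=; apply: leq_sum => w _.
  case: (boolP (success a w)) => // /success_cases/orP[|->]; last by rewrite addn1.
  case/existsP=> t /existsP[j /andP[tj hit]].
  by rewrite (bigD1 t) //= (bigD1 j) //= hit.
rewrite mulnDl mulnDl mul1n leq_add ?card_lucky_guess //.
rewrite big_distrl /=.
have -> : (3 * (T * T.+1) * #|{: omega}| = \sum_(t < T) T.+1 * (3 * #|{: omega}|))%N.
  by rewrite sum_nat_const card_ord; lia.
apply: leq_sum => t _; rewrite big_distrl /=.
have -> : (T.+1 * (3 * #|{: omega}|) = \sum_(j < T.+1) 3 * #|{: omega}|)%N.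
  by rewrite sum_nat_const card_ord.
rewrite big_mkcond /=; apply: leq_sum => j _; case: ifP => // tj.
by apply: card_early_hit; rewrite tj ltn_ord.
Qed.

End HardDistribution.

(** * Averaging over the coins *)

From mathcomp Require Import all_classical all_reals all_analysis.
From mathcomp Require Import measurable_realfun.
Local Open Scope classical_set_scope.
Local Open Scope ring_scope.

Section Measurability.
Variables (R : realType) (V : finType) (A : randomized_algorithm R V).

Lemma measurable_transcript_eq (f : V -> R) k h :
  measurable [set w : coins A | transcript (run_with w) f k = h].
Proof.
elim: k h => [|k IHk] h /=.
  have [->|nh] := pselect (h = [::]).
    by rewrite (_ : [set _ | _] = setT) //; apply/seteqP; split.
  by rewrite (_ : [set _ | _] = set0) //; apply/seteqP; split=> // w /= /esym.
pose stop := \bigcup_(v : V) ([set w : coins A | transcript (run_with w) f k = h] `&`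
  [set w | run_with w h = inr v]).
pose go := \bigcup_(v : V) \bigcup_(h' in [set h' | rcons h' (v, f v) = h])
  ([set w : coins A | transcript (run_with w) f k = h'] `&` [set w | run_with w h' = inl v]).
rewrite (_ : [set _ | _] = stop `|` go); last first.
  apply/seteqP; split=> w /=.
    case E: (run_with w _) => [v|v] eh; [right; exists v => //|left; exists v => //].
      by exists (transcript (run_with w) f k).
    by rewrite /setI /= -{2}eh.
  case=> [[v _ [/= -> ->]]//|[v _ [h' /= <- [/= -> ->]]]//].
apply: measurableU.
  apply: countable_bigcupT_measurable => // v; apply: measurableI => //.
  exact: measurable_action.
apply: countable_bigcupT_measurable => // v.
(* The union over [h'] ranges over an uncountable type, but at most one [h'] satisfies
   [rcons h' (v, f v) = h]. *)
case/lastP: h {stop go} => [|h y].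
  rewrite (_ : \bigcup_(_ in _) _ = set0) //; apply/seteqP; split=> // w [h' /=].
  by move/(congr1 size); rewrite size_rcons.
have [->|nv] := pselect (y = (v, f v)); last first.
  rewrite (_ : \bigcup_(_ in _) _ = set0) //; apply/seteqP; split=> // w [h' /=].
  by case/rcons_inj => _ /esym.
rewrite (_ : [set h' | _] = [set h]); last first.
  by apply/seteqP; split=> h' /= => [/rcons_inj[]|->].
rewrite bigcup_set1; apply: measurableI => //; exact: measurable_action.
Qed.

(** Since [f] determines the answers, a transcript is given by its vertex list; there are only
    countably many of those. *)
Lemma measurable_run (f : V -> R) k (Q : seq (V * R) -> V + V -> Prop) :
  measurable [set w : coins A |
    Q (transcript (run_with w) f k) (run_with w (transcript (run_with w) f k))].
Proof.
pose log (vs : seq V) := [seq (v, f v) | v <- vs].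
rewrite (_ : [set _ | _] = \bigcup_(vs : seq V) \bigcup_(x in [set x : V + V | Q (log vs) x])
   ([set w : coins A | transcript (run_with w) f k = log vs] `&`
    [set w | run_with w (log vs) = x])); last first.
  apply/seteqP; split=> w /= => [Qw|[vs _ [x /= Qx [/= -> ->]]]//].
  have trE := transcript_map (run_with w) f k.
  exists (unzip1 (transcript (run_with w) f k)) => //.
  by exists (run_with w (transcript (run_with w) f k)); rewrite /= /log -trE.
apply: countable_bigcupT_measurable => // vs.
apply: fin_bigcup_measurable => [|x _]; first exact: finite_finset.
by apply: measurableI; [apply: measurable_transcript_eq|apply: measurable_action].
Qed.

Lemma measurable_num_queries (f : V -> R) :
  measurable_fun [set: coins A] (fun w => num_queries (run_with w) f).
Proof.
rewrite (_ : (fun w => _) = (fun w => esups (fun k =>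
    (size (transcript (run_with w) f k))%:R%:E) 0%N)); last first.
  by apply/funext=> w; congr ereal_sup; apply/seteqP; split=> _ [k _ <-]; exists k.
apply: measurable_fun_esups => k; apply/measurable_EFinP => _ Y mY.
by rewrite setTI; apply: (measurable_run f k (fun h _ => Y (size h)%:R)).
Qed.

End Measurability.

Section Averaging.
Variables (R : realType) (V : finType) (A : randomized_algorithm R V).

(** An algorithm that still queries at step [T] makes at least [T.+1] queries; the rest is Markov's
    inequality. *)
Lemma expected_queries_ge (f : V -> R) T (p : R) :
  (p%:E <= coins_law A [set w | exists v, run_with w (transcript (run_with w) f T) = inl v])%E ->
  ((T.+1%:R * p)%:E <= expected_queries A f)%E.
Proof.
set Q := [set w | _] => leQ.
have mQ : measurable Q.
  exact: (measurable_run A f T (fun _ x => exists v, x = inl v)).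
apply: (@le_trans _ _ (\int[coins_law A]_w (T.+1%:R%:E * (\1_Q w)%:E))%E).
  rewrite ge0_integralZl_EFin //; last exact/measurable_EFinP/measurable_indic.
  by rewrite integral_indic // setIT EFinM lee_pmul2l // lte_fin ltr0n.
apply: ge0_le_integral => //.
- apply: measurable_funeM; exact/measurable_EFinP/measurable_indic.
- exact: measurable_num_queries.
- move=> w _; rewrite indicE; case: (boolP (w \in Q)) => wQ; last first.
    by rewrite mule0; apply: (@le_trans _ _ 0%:R%:E) => //; apply: ereal_sup_ubound; exists 0%N.
  rewrite mule1; move: wQ; rewrite inE => -[v av]; apply: ereal_sup_ubound.
  by exists T.+1 => //=; rewrite av size_rcons (size_transcript av).
Qed.

(** The easy half of Yao's principle: a bound for every fixed outcome of the coins on the fraction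
    of bad inputs gives one input that is bad for the random coins with probability at most [p]. *)
Lemma exists_small_event (O : finType) (G : O -> set (coins A)) (p : R) :
  (0 < #|O|)%N -> (forall o, measurable (G o)) ->
  (forall w, (\sum_o \1_(G o) w)%R <= p * #|O|%:R) ->
  exists o, (coins_law A (G o) <= p%:E)%E.
Proof.
move=> O0 mG leG; apply: contrapT => /forallNP no.
have mI o : measurable_fun setT (fun w => (\1_(G o) w)%:E : \bar R).
  exact/measurable_EFinP/measurable_indic.
have : (\sum_(o : O) coins_law A (G o) <= (p * #|O|%:R)%:E)%E.
  have -> : (\sum_(o : O) coins_law A (G o) =
      \int[coins_law A]_w (\sum_(o : O) (\1_(G o) w)%:E))%E.
    rewrite ge0_integral_sum //.
    by apply: eq_bigr => o _; rewrite integral_indic // setIT.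
  have -> : (p * #|O|%:R)%:E = (\int[coins_law A]_w (cst (p * #|O|%:R)%:E w))%E.
    by rewrite integral_cst // [X in (_ * X)%E]probability_setT mule1.
  apply: ge0_le_integral => //.
  - by move=> w _; apply: sume_ge0 => o _; rewrite lee_fin.
  - by apply: emeasurable_sum.
  - by move=> w _; rewrite sumEFin lee_fin.
apply/negP; rewrite -ltNge.
have -> : (p * #|O|%:R)%:E = (\sum_(o : O) p%:E)%E.
  by rewrite sumEFin sumr_const mulr_natr.
have [i0 _] : exists i : O, i \in O by apply/card_gt0P.
have finG o : coins_law A (G o) \is a fin_num by apply: fin_num_measure.
have -> : (\sum_(o : O) coins_law A (G o) = \sum_(o : O) (fine (coins_law A (G o)))%:E)%E.
  by apply: eq_bigr => o _; rewrite fineK.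
rewrite !sumEFin lte_fin; apply: ltr_sum; first by apply/hasP; exists i0; rewrite ?mem_index_enum.
by move=> o _; rewrite -lte_fin fineK // ltNge; apply/negP/no.
Qed.

End Averaging.

(** * Choice of parameters and the final bound *)

Lemma separation_number_attained (V : finType) (e : rel V) :
  (0 < separation_number e)%N -> exists H : {set V}, (1 < #|H|)%N /\
    forall A, balanced H A -> (separation_number e <= #|separator e H A|)%N.
Proof.
rewrite /separation_number => s0.
have [H0 H0gt1] : exists H : {set V}, (2 <= #|H|)%N.
  apply: contrapT => /forallNP no; move: s0; rewrite big1 // => H HH.
  by case: (no H).
have [|H Hgt1 ->] := @eq_bigmax_cond _ (fun H : {set V} => (2 <= #|H|)%N)
    (fun H => \big[minn/#|V|]_(A : {set V} | balanced H A) #|separator e H A|).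
  by apply/card_gt0P; exists H0.
exists H; split=> // A bA.
have := mem_index_enum A; elim: (index_enum _) => // B r IHr.
rewrite inE big_cons => /orP[/eqP<-|/IHr le]; first by rewrite bA geq_minl.
by case: ifP => // _; apply: leq_trans le; apply: geq_minr.
Qed.

Lemma expected_queries_lower_bound (R : realType) (V : finType) (e : rel V)
    (A : randomized_algorithm R V) T :
  symmetric e -> (forall u v : V, connect e u v) -> (0 < T)%N ->
  ((4 * T) ^ 4 <= separation_number e)%N -> solves_local_search e A ->
  exists f : V -> R, ((T.+1%:R * (37 / 80))%:E <= expected_queries A f)%E.
Proof.
move=> sym_e conn_e T0 leTs solA.
have [|H [H1 sepH]] := @separation_number_attained V e.
  by apply: leq_trans leTs; rewrite expn_gt0 muln_gt0 T0.
(* Chosen so that [M * M = (4 * T) ^ 4], which is at most the separation number. *)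
pose M := (16 * T ^ 2)%N.
have M0 : (0 < M)%N by rewrite muln_gt0 expn_gt0 T0.
have [|r [seg [r_inj seg_path seg_cong]]] :=
    low_congestion_routing sym_e H1 sepH M0.
  by apply: leq_trans leTs; rewrite /M; lia.
pose x0 : 'I_M := Ordinal M0.
have [D dD] := distance_to (r x0) conn_e.
pose O : finType := {ffun 'I_T.+1 -> 'I_M * 'I_M}.
pose F (o : O) : V -> R := hard R seg x0 D o T.+1.
pose G (o : O) := [set w : coins A |
  run_with w (transcript (run_with w) (F o) T) = inr (r (milestone x0 o T.+1))].
have mG o : measurable (G o).
  exact: (measurable_run A (F o) T (fun _ x => x = inr (r (milestone x0 o T.+1)))).
have O0 : (0 < #|O|)%N.
  by rewrite card_ffun card_prod !card_ord expn_gt0 muln_gt0 M0.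
(* For [T >= 1], [3 * (T * T.+1) + 1 <= 7 * T ^ 2]; dividing by [M] gives 7/16. *)
have [|o leG] := @exists_small_event _ _ A O G (7 / 16) O0 mG.
  move=> w; pose S := [set o : O | success r seg x0 D (run_with w) o]%SET.
  have -> : \sum_o \1_(G o) w = #|S|%:R :> R.
    rewrite card_sum_bool natr_sum; apply: eq_bigr => o _; rewrite indicE.
    by congr (_%:R); congr nat_of_bool; apply/idP/eqP; rewrite inE.
  have cS := card_success T r_inj seg_cong x0 D (run_with w).
  have {cS} cS : (#|S| * 16 <= 7 * #|O|)%N.
    have T2 : (0 < T ^ 2)%N by rewrite expn_gt0 T0.
    rewrite -(leq_pmul2r T2) -mulnA (leq_trans cS) //.
    by rewrite [(7 * _ * _)%N]mulnAC leq_mul2r; apply/orP; right; nia.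
  have : (#|S| * 16)%:R <= (7 * #|O|)%:R :> R by rewrite ler_nat.
  by rewrite !natrM; lra.
exists (F o); apply: expected_queries_ge.
set Q := [set w | _].
have mQ : measurable Q.
  exact: (measurable_run A (F o) T (fun _ x => exists v, x = inl v)).
have := solA (F o); set S := [set w | _] => leS.
have SE : S = \bigcup_(v in [set v | local_minimum e (F o) v]) \bigcup_(k : nat)
    [set w : coins A | run_with w (transcript (run_with w) (F o) k) = inr v].
  apply/seteqP; split=> w /=; first by case=> v [k kv] minv; exists v => //; exists k.
  by case=> v minv [k _ kv]; exists v => //; exists k.
have mS : measurable S.
  rewrite SE; apply: fin_bigcup_measurable => [|v _]; first exact: finite_finset.
  apply: bigcupT_measurable => k.
  exact: (measurable_run A (F o) k (fun _ x => x = inr v)).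
(* A correct run either still queries at step [T] or has stopped by then at the end of the walk, the
   only possible local minimum. Hence [Q] has probability at least 9/10 - 7/16 = 37/80. *)
have SQG : S `<=` Q `|` G o.
  move=> w [v [k kv] minv]; case E: (run_with w (transcript (run_with w) (F o) T)) => [u|u].
    by left; exists u.
  right; rewrite /G /= E; congr inr.
  have [pw lw] := walk_path x0 o T.+1 seg_path.
  rewrite -lw -(staircase_local_minimum dD pw minv).
  case: (leqP k T) => kT.
    by move: E; rewrite (transcript_stop kT kv) kv => -[].
  by move: kv; rewrite (transcript_stop (ltnW kT) E) E => -[].
have : (coins_law A S <= coins_law A Q + coins_law A (G o))%E.
  apply: le_trans (measureU2 _ mQ (mG o)).
  by apply: le_measure; rewrite ?inE //; apply: measurableU.
move/(le_trans leS); rewrite -(fineK (fin_num_measure _ _ mQ)).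
move: leG; rewrite -(fineK (fin_num_measure _ _ (mG o))) -EFinD !lee_fin.
lra.
Qed.

Theorem theorem2 (R : realType) :
  exists c k0 : R, 0 < c /\
    forall (V : finType) (e : rel V),
      symmetric e -> irreflexive e -> (forall u v : V, connect e u v) ->
      let ratio : R := (separation_number e)%:R / (max_degree e)%:R in
      k0 <= ratio ->
      ((c * ratio `^ (1 / 4))%:E <= randomized_query_complexity R e)%E.
Proof.
(* 256 is [4 ^ 4], so that some [T >= 1] satisfies [(4 * T) ^ 4 <= s]. For the largest such [T], the
   fourth root of the ratio is at most [4 * T.+1], and 4/20 is below 37/80. *)
exists (1 / 20), 256; split; first by lra.
move=> V e sym_e _ conn_e ratio le_ratio; set s := separation_number e in ratio le_ratio *.
(* For maximum degree 0 the quotient is 0 by convention; otherwise the divisor is at least 1. *)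
have ratio_s : ratio <= s%:R.
  rewrite /ratio; case: (max_degree e) => [|d]; first by rewrite invr0 mulr0.
  by rewrite ler_pdivrMr ?ltr0n // ler_peMr ?ler0n // ler1n.
have s256 : (256 <= s)%N by rewrite -(ler_nat R) (le_trans le_ratio).
have [T T0 /andP[leT ltT]] : exists2 T, (0 < T)%N & ((4 * T) ^ 4 <= s < (4 * T.+1) ^ 4)%N.
  have ub n : ((4 * n) ^ 4 <= s)%N -> (n <= s)%N.
    case: n => // n; apply: leq_trans; apply: leq_trans (leq_pmull _ (isT : 0 < 4)%N) _.
    by rewrite -[X in (X <= _)%N]expn1 leq_pexp2l.
  have ex : exists n, ((4 * n) ^ 4 <= s)%N by exists 1%N.
  case: (ex_maxnP ex ub) => T leT maxT; exists T; first exact: maxT.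
  by rewrite leT ltnNge; apply/negP => /maxT; rewrite ltnn.
apply: le_ereal_inf_tmp => _ [A [solA <-]].
have [f lef] := expected_queries_lower_bound sym_e conn_e T0 leT solA.
apply: (@le_trans _ _ (expected_queries A f)); last first.
  by apply: ereal_sup_ubound; exists f.
apply: le_trans lef; rewrite lee_fin.
have : ratio `^ (1 / 4) <= 4 * T.+1%:R.
  have ge0 : 0 <= 4 * T.+1%:R :> R by rewrite mulr_ge0 // ler0n.
  have -> : 4 * T.+1%:R = ((4 * T.+1%:R) ^+ 4) `^ (1 / 4) :> R.
    rewrite -powR_mulrn // -powRrM; rewrite (_ : 4%:R * (1 / 4) = 1); first by rewrite powRr1.
    by rewrite mul1r divff // pnatr_eq0.
  apply: ge0_ler_powR; rewrite ?nnegrE ?exprn_ge0 //; first by lra.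
  apply: le_trans ratio_s _; rewrite -natrM -natrX ler_nat; exact: ltnW.
by have := ler0n R T.+1; lra.
Qed.
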